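(* Let $n\ge2$ and let $\widetilde{\mathcal T}_n=\mathcal T_n\times\mathbb Z/n\mathbb Z$ with the maps $\sigma_1,\dots,\sigma_{n-1}$ defined in the context. With $\delta_n=\sigma_1\sigma_2\cdots\sigma_{n-1}$ (apply $\sigma_{n-1}$ first), applying $\delta_n$ $n$ times gives $\delta_n^n(T,\varepsilon)=(T,\varepsilon-1)$ for all $(T,\varepsilon)\in\widetilde{\mathcal T}_n$. Consequently the Garside element squared, $\Delta^2=\delta_n^n$ where $\Delta=\delta_n\delta_{n-1}\cdots\delta_2$ and $\delta_m=\sigma_1\cdots\sigma_{m-1}$, acts as the identity on $\mathcal T_n$, and $\Delta^{2n}$ acts as the identity on $\widetilde{\mathcal T}_n$.
   Context: $\mathcal T_n$ is the set of rooted trees with vertices labeled $1,\dots,n$; $v_i$ is the vertex labeled $i$. Maps $\sigma_i$ on $\mathcal T_n$: if $v_{i+1}$ is the root of $T$, $\sigma_iT$ is $T$ with labels $i,i+1$ interchanged. Otherwise form $T_+$ by adding a vertex $v_0$ as parent of the root, write $a\to b$ for ''$a$ is the parent of $b$'', and: (0) if neither of $v_i,v_{i+1}$ is the parent of the other and they have different parents, interchange labels $i,i+1$; (1) if $v_k\to v_i\to v_{i+1}$, make $v_k\to v_{i+1}\to v_i$, other relations unchanged; (2) if $v_k\to v_{i+1}\to v_i$, make $v_i,v_{i+1}$ both children of $v_k$ and interchange their sets of other children; (3) if $v_i,v_{i+1}$ share parent $v_k$, interchange their sets of children and then make $v_{i+1}$ a child of $v_i$; then delete $v_0$. Reduced weight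 in $T$ with root $v_r$: $\overline w(v_r)=1$; if $v_i$ is a child of the root, $\overline w(v_i)$ is the number of vertices of the subtree rooted at $v_i$ (including $v_i$); otherwise $\overline w(v_i)=0$. On $\widetilde{\mathcal T}_n$ (augmented rooted labeled trees $(T,\varepsilon)$), if $v_r$ is the root of $T$: $\sigma_i(T,\varepsilon)=(\sigma_iT,\varepsilon)$ for $i\ne r-1$, and $\sigma_{r-1}(T,\varepsilon)=(\sigma_{r-1}T,\varepsilon+\overline w(v_{r-1}))$ with $\overline w$ computed in $T$. These maps define actions of the braid group $B_n$ on $\mathcal T_n$ (via the first components) and on $\widetilde{\mathcal T}_n$. *)

(* Defs.v *)
From mathcomp Require Import all_boot all_order all_algebra all_fingroup.
Set Implicit Arguments. Unset Strict Implicit. Unset Printing Implicit Defensive.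
Import GRing.Theory.
Local Open Scope ring_scope.

(* Labels 1..n are represented by indices 0..n-1 of 'I_n: the vertex labelled
   k is the index k-1.  A rooted labelled tree is given by its parent
   function: [p x = Some y] means y is the parent of x, [p x = None] means x
   is the root (equivalently, x is a child of the auxiliary vertex v_0). *)
Definition tree (n : nat) := {ffun 'I_n -> option 'I_n}.

Section Trees.
Variable n : nat.
Implicit Types (p : tree n) (a b x : 'I_n).

Definition up p (x : option 'I_n) : option 'I_n := obind p x.

Definition is_tree p : bool :=
  (#|[pred x | p x == None]| == 1)%N &&
  [forall x, [exists k : 'I_n.+1, iter k (up p) (Some x) == None]].

Definition relabel p a b : tree n :=
  [ffun x => omap (tperm a b) (p (tperm a b x))].

Definition chsw a b (y : option 'I_n) : option 'I_n :=
  if y == Some a then Some b else if y == Some b then Some a else y.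

Definition sigma_pair p a b : tree n :=
  if p b == None then relabel p a b
  else if [&& p a != Some b, p b != Some a & p a != p b]
    then relabel p a b
  else if p b == Some a then
    [ffun x => if x == b then p a else if x == a then Some b else p x]
  else if p a == Some b then
    [ffun x => if (x == a) || (x == b) then p b else chsw a b (p x)]
  else
    [ffun x => if x == b then Some a else if x == a then p a
               else chsw a b (p x)].

Definition sigma (i : nat) p : tree n :=
  match insub (i.-1) : option 'I_n, insub i : option 'I_n with
  | Some a, Some b => sigma_pair p a b
  | _, _ => p
  end.

Definition subtree p x : pred 'I_n :=
  [pred y | [exists k : 'I_n, iter k (up p) (Some y) == Some x]].

Definition wbar p x : nat :=
  if p x is Some r then (if p r == None then #|subtree p x| else 0) else 1.

Definition sigmaA (i : nat) (te : tree n * 'Z_n) : tree n * 'Z_n :=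
  let: (p, e) := te in
  match insub (i.-1) : option 'I_n, insub i : option 'I_n with
  | Some a, Some b =>
      (sigma_pair p a b, if p b == None then e + (wbar p a)%:R else e)
  | _, _ => (p, e)
  end.

(* Words: [:: i1; i2; ...; ik] stands for sigma_{i1} sigma_{i2} ... sigma_{ik},
   acting with sigma_{ik} first. *)
Definition actT (w : seq nat) p : tree n := foldr sigma p w.
Definition actA (w : seq nat) te : tree n * 'Z_n := foldr sigmaA te w.
End Trees.

Definition delta (m : nat) : seq nat := iota 1 m.-1.
Definition Delta (n : nat) : seq nat :=
  flatten [seq delta m | m <- rev (iota 2 n.-1)].
Definition wpow (w : seq nat) (k : nat) : seq nat := flatten (nseq k w).

(* Main.v *)
Require Import Defs.
From mathcomp Require Import all_boot all_order all_algebra all_fingroup.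
Import GRing.Theory.
Set Implicit Arguments. Unset Strict Implicit. Unset Printing Implicit Defensive.

(* Regard sigma_i as moving the vertex v_{i+1} past v_i: up to exchanging the
   two labels, it then only modifies the tree locally (v_i switches between
   being a child and a sibling of v_{i+1}, or, if v_i is the parent of v_{i+1},
   the two exchange their other children).  When delta_n moves v_n past all the
   other vertices, the exchange at the parent of v_n makes these modifications
   cancel out, so delta_n just rotates the labels; it changes epsilon only if
   v_n is the root, by the sum n - 1 = -1 of the sizes of the subtrees below
   the root.  During n rotations each vertex is v_n exactly once, which gives
   the action of delta_n^n.

   Distant sigma_i clearly commute, and equivariance under relabelling gives
   delta_n sigma_i = sigma_{i+1} delta_n.  In a group these two families of
   relations imply Delta^2 = delta_n^n, so that the braid relation need not be
   checked on trees.  The sigma_i are bijective because delta_n is. *)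

(** * Well-foundedness of parent functions and membership in subtrees *)

Section Trees.
Variable n : nat.
Implicit Types (p : tree n) (a b c d x y z r : 'I_n) (s t : {perm 'I_n}).

(** Acyclicity phrased as an induction principle; the root is the base case, since its premise is
    vacuous. *)
Definition parent_induction p := forall P : 'I_n -> Prop,
  (forall y, (forall z, p y = Some z -> P z) -> P y) -> forall y, P y.

Lemma iter_up_None p k : iter k (up p) None = None.
Proof. by elim: k => //= k ->. Qed.

Lemma is_treeP p : reflect
  ((exists r, forall x, (p x == None) = (x == r)) /\ parent_induction p)
  (is_tree p).
Proof.
apply: (iffP andP) => [[/card1P[r Hr] /forallP Hk]|[[r Hr] Hp]]; split.
- by exists r => x; have := Hr x; rewrite !inE.
- move=> P HP y; have /existsP[[k _] /= /eqP] := Hk y.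
  elim: k y => [|k IH] y //.
  rewrite iterSr /= => Hy; apply: HP => z Ez; apply: IH.
  by rewrite Ez in Hy.
- by apply/card1P; exists r => x; rewrite !inE Hr.
- apply/forallP=> x; apply/existsP.
  have [k Ek] : exists k, iter k (up p) (Some x) = None.
    elim/Hp: x => x IH; case E: (p x) => [z|]; last by exists 1.
    by have [k Ek] := IH z E; exists k.+1; rewrite iterSr /= E.
  (* All iterates lie in [option 'I_n], which has [n.+1] elements, so [None] is first met after at
     most [n] steps. *)
  have Hc : fconnect (up p) (Some x) None by rewrite -Ek fconnect_iter.
  have Hlt : findex (up p) (Some x) None < n.+1.
    apply: leq_trans (findex_max Hc) _; apply: leq_trans (max_card _) _.
    by rewrite card_option card_ord.
  by exists (Ordinal Hlt); rewrite /= iter_findex.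
Qed.

(** Being different from [x] would pass from parents to children: only [x] could violate it, and its
    parent would be [x] itself. *)
Lemma tree_no_loop p x : is_tree p -> p x <> Some x.
Proof.
case/is_treeP=> _ Hp Ex.
suff H : forall y, y <> x by exact: (H x).
by elim/Hp => y IH Ey; rewrite Ey in IH; apply: (IH x Ex).
Qed.

Lemma tree_no_two_cycle p a b : is_tree p -> p a = Some b -> p b <> Some a.
Proof.
case/is_treeP=> _ Hp Ea Eb.
suff H : forall y, y <> a /\ y <> b by case: (H a).
by elim/Hp => y IH; split=> Ey; subst y; [case: (IH b Ea)|case: (IH a Eb)].
Qed.

Lemma tree_root_uniq p a b : is_tree p -> p a = None -> p b = None -> a = b.
Proof.
case/is_treeP=> -[r Hr] _ /eqP + /eqP.
by rewrite !Hr => /eqP-> /eqP->.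
Qed.

(** Since [up p] fixes [None], the shortest path from [y] to [x] consists of distinct vertices, so
    it has fewer than [n] steps; this is the bound built into [subtree]. *)
Lemma subtreeP p x y :
  reflect (exists k, iter k (up p) (Some y) = Some x) (subtree p x y).
Proof.
apply: (iffP existsP) => [[k /eqP Hk]|[k0 Hk0]]; first by exists k.
have Hc : fconnect (up p) (Some y) (Some x) by rewrite -Hk0 fconnect_iter.
set k := findex (up p) (Some y) (Some x).
have Hk : iter k (up p) (Some y) = Some x by rewrite iter_findex.
suff Hlt : k < n by exists (Ordinal Hlt); rewrite /= Hk.
have Hu : uniq (take k.+1 (fingraph.orbit (up p) (Some y))).
  exact: take_uniq (fingraph.orbit_uniq _ _).
have Hs : size (take k.+1 (fingraph.orbit (up p) (Some y))) = k.+1.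
  by rewrite size_takel // size_orbit findex_max.
rewrite -[leqRHS](size_enum_ord n) -(size_map Some) -[leqLHS]Hs.
apply: uniq_leq_size => //; case=> [u _|]; first by rewrite map_f ?mem_enum.
case/(nthP (Some y)) => i; rewrite Hs => Hi.
rewrite nth_take // /fingraph.orbit nth_traject; last first.
  exact: leq_trans Hi (findex_max Hc).
by move=> Ei; move: Hk; rewrite -(subnK (Hi : i <= k)) iterD Ei iter_up_None.
Qed.

Lemma subtreeE p x y :
  subtree p x y = (y == x) || (if p y is Some z then subtree p x z else false).
Proof.
apply/subtreeP/orP => [[[|k]]|].
- by case=> ->; left.
- rewrite iterSr /=; case E: (p y) => [z|]; last by rewrite iter_up_None.
  by move=> Hk; right; apply/subtreeP; exists k.
- case=> [/eqP->|]; first by exists 0.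
  case E: (p y) => [z|] // /subtreeP[k Hk].
  by exists k.+1; rewrite iterSr /= E.
Qed.

(** By parent induction the recursion [subtreeE] has a single solution, so a subtree in a modified
    tree can be guessed and then checked one step at a time. *)
Lemma subtree_charact p x (D : pred 'I_n) : is_tree p ->
  (forall y, D y = (y == x) || (if p y is Some z then D z else false)) ->
  subtree p x =1 D.
Proof.
case/is_treeP=> _ Hp HD; elim/Hp => y IH.
rewrite subtreeE HD; case E: (p y) => [z|] //.
by rewrite (IH _ E).
Qed.

(** * Transport of trees along permutations of the labels *)

Definition relab s p : tree n := [ffun x => omap s (p (s^-1%g x))].

Lemma relabE s p x : relab s p (s x) = omap s (p x).
Proof. by rewrite ffunE permK. Qed.

Lemma relabM s t p : relab s (relab t p) = relab (t * s)%g p.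
Proof.
apply/ffunP=> x; rewrite !ffunE invMg permM; case: (p _) => //= y.
by rewrite permM.
Qed.

Lemma relab1 p : relab 1%g p = p.
Proof.
apply/ffunP=> x; rewrite ffunE invg1 perm1.
by case: (p x) => //= y; rewrite perm1.
Qed.

Lemma relab_inj s : injective (relab s).
Proof.
move=> p q E; rewrite -(relab1 p) -(relab1 q) -(mulgV s).
by rewrite -!relabM E.
Qed.

Lemma omap_perm_eq s (u v : option 'I_n) : (omap s u == omap s v) = (u == v).
Proof.
case: u v => [w|] [w'|] //=.
have E (a b : 'I_n) : (Some a == Some b) = (a == b) by [].
by rewrite !E (inj_eq perm_inj).
Qed.

Lemma relab_eqNone s p x : (relab s p (s x) == None) = (p x == None).
Proof. by rewrite relabE -[None in LHS]/(omap s None) omap_perm_eq. Qed.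

Lemma relab_eqSome s p x y : (relab s p (s x) == Some (s y)) = (p x == Some y).
Proof. by rewrite relabE -[Some (s y)]/(omap s (Some y)) omap_perm_eq. Qed.

Lemma relab_eq s p x y : (relab s p (s x) == relab s p (s y)) = (p x == p y).
Proof. by rewrite !relabE omap_perm_eq. Qed.

Lemma is_tree_relab s p : is_tree p -> is_tree (relab s p).
Proof.
case/is_treeP=> -[r Hr] Hp; apply/is_treeP; split.
  exists (s r) => x; rewrite -(permKV s x) relab_eqNone Hr.
  by rewrite (inj_eq perm_inj).
move=> P HP y; rewrite -(permKV s y); move: (_ y) => {}y.
elim/Hp: y => y IH; apply: HP => z; rewrite relabE.
by case E: (p y) => [w|] //= [<-]; apply: IH.
Qed.

Lemma wbar_relab s p x : is_tree p -> wbar (relab s p) (s x) = wbar p x.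
Proof.
move=> Tp; rewrite /wbar relabE; case E: (p x) => [r|] //=.
rewrite relab_eqNone; case: ifP => // _.
rewrite -(card_image (@perm_inj _ s) (subtree p x)); apply: eq_card => y.
rewrite -(permKV s y); move: (_ y) => {}y.
rewrite mem_image; last exact: perm_inj.
rewrite /in_mem /=.
(* The guess is the image under [s] of the subtree below [x]. *)
rewrite (@subtree_charact _ _ (fun z => subtree p x (s^-1%g z))) ?permK //.
  exact: is_tree_relab.
move=> z; rewrite -(permKV s z) permK relabE subtreeE (inj_eq perm_inj).
by case: (p _) => //= w; rewrite permK.
Qed.

(** * Slides: the generators without their exchange of labels *)

(* [sigma_pair] up to the final exchange of the labels [a] and [b]. *)
Definition slide p a b : tree n :=
  if p b == None then p
  else if p b == Some a then
    [ffun x => if x == b then Some a else omap (tperm a b) (p x)]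
  else if p a == Some b then [ffun x => if x == a then p b else p x]
  else if p a == p b then [ffun x => if x == a then Some b else p x]
  else p.

Lemma chswE a b u : chsw a b u = omap (tperm a b) u.
Proof.
case: u => [y|]; rewrite /chsw //=.
case: tpermP => [->|->|/eqP H1 /eqP H2]; rewrite ?eqxx //.
  by case: eqP => // -[->].
have -> : Some y == Some a = (y == a) by [].
have -> : Some y == Some b = (y == b) by [].
by rewrite (negPf H1) (negPf H2).
Qed.

Lemma relabelE p a b : relabel p a b = relab (tperm a b) p.
Proof. by apply/ffunP=> x; rewrite !ffunE tpermV. Qed.

Lemma omap_tperm_id a b (u : option 'I_n) :
  u <> Some a -> u <> Some b -> omap (tperm a b) u = u.
Proof.
by case: u => //= y Ha Hb; rewrite tpermD //; apply/eqP=> E; subst y.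
Qed.

Lemma omap_tpermK a b (u : option 'I_n) :
  omap (tperm a b) (omap (tperm a b) u) = u.
Proof. by case: u => //= y; rewrite tpermK. Qed.

(** Undoing the label exchange in case (2) leaves [a] moved from child to sibling of [b], and in
    case (3) the reverse. In case (1) it leaves both vertices in place with their other children
    exchanged. *)
Lemma sigma_pairE p a b : is_tree p -> a != b ->
  sigma_pair p a b = relab (tperm a b) (slide p a b).
Proof.
move=> Tp ab; rewrite /sigma_pair /slide !relabelE.
case: ifP => // /negbT/eqP Nb.
have La := @tree_no_loop _ a Tp; have Lb := @tree_no_loop _ b Tp.
have C2 := @tree_no_two_cycle _ a b Tp.
case: (eqVneq (p b) (Some a)) => [Eb|Nba] /=.
  rewrite andbF; apply/ffunP=> x; rewrite !ffunE tpermV.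
  case: tpermP => [->|->|/eqP H1 /eqP H2].
  - by rewrite (negPf ab) !eqxx /= tpermL.
  - rewrite eqxx (negPf ab) omap_tpermK //.
  - by rewrite (negPf H1) (negPf H2) omap_tpermK.
case: (eqVneq (p a) (Some b)) => [Ea|Nab] /=.
  apply/ffunP=> x; rewrite !ffunE tpermV chswE.
  have Hb : omap (tperm a b) (p b) = p b.
    by apply: omap_tperm_id => //; apply/eqP.
  case: tpermP => [->|->|/eqP H1 /eqP H2].
  - by rewrite eqxx /= eq_sym (negPf ab) Hb.
  - by rewrite !eqxx orbT /= Hb.
  - by rewrite (negPf H1) (negPf H2).
case: eqVneq => [E|N] /=; last by [].
apply/ffunP=> x; rewrite !ffunE tpermV chswE.
case: tpermP => [->|->|/eqP H1 /eqP H2].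
- rewrite !eqxx (negPf ab) -E.
  rewrite [b == a]eq_sym (negPf ab) omap_tperm_id //; exact/eqP.
- by rewrite !eqxx /= tpermR.
- by rewrite (negPf H1) (negPf H2).
Qed.

Lemma slide_eqNone p a b x : is_tree p ->
  (slide p a b x == None) = (p x == None).
Proof.
move=> Tp; rewrite /slide; case: ifP => // Nb.
case: ifP => [/eqP Eb|_].
  rewrite ffunE; case: (x =P b) => [->|_]; first by rewrite Eb.
  by rewrite -[None in LHS]/(omap (tperm a b) None) omap_perm_eq.
case: ifP => [/eqP Ea|_].
  by rewrite ffunE; case: (x =P a) => [->|] //; rewrite Ea Nb.
case: ifP => [/eqP Ea|_] //.
by rewrite ffunE; case: (x =P a) => [->|] //; rewrite Ea Nb.
Qed.

Lemma slide_tree p a b : is_tree p -> a != b -> is_tree (slide p a b).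
Proof.
move=> Tp ab; have /is_treeP[[r Hr] Hp] := Tp; apply/is_treeP; split.
  by exists r => x; rewrite slide_eqNone.
have La := @tree_no_loop _ a Tp; have Lb := @tree_no_loop _ b Tp.
have C2 := @tree_no_two_cycle _ a b Tp.
move=> P HP y.
(* Including the parent gives access to the grandparent of [y], which becomes the new parent when a
   child of [b] passes to [a] or when [a] moves up beside [b]. *)
suff : P y /\ forall z, p y = Some z -> P z by case.
elim/Hp: y => y IH.
have IH1 z : p y = Some z -> P z by case/IH.
split=> //; apply: (HP) => z; rewrite /slide in HP *.
case: eqP HP => [_|Nb] HP; first exact: IH1.
case: eqP HP => [Eb|Nba] HP.
  rewrite ffunE; case: (y =P b) => [Ey [<-]|Nyb]; first by apply: IH1; rewrite Ey.
  case E: (p y) => [w|] //= [<-].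
  have [Pw Pw'] := IH _ E.
  case: tpermP => [Ewa|Ewb|_ _] //; last by apply: Pw'; rewrite Ewb.
  (* Here [y] passes from [a] to [b], and [b] itself still hangs below [a], where [P] is known. *)
  apply: HP => u; rewrite ffunE eqxx => -[<-].
  by rewrite -Ewa.
case: eqP HP => [Ea|_] HP.
  rewrite ffunE; case: (y =P a) => [Ey|_]; last exact: IH1.
  by move=> Ez; rewrite -Ey in Ea; have [_] := IH _ Ea; apply.
case: eqP HP => [Ea|_] HP; last exact: IH1.
rewrite ffunE; case: (y =P a) => [Ey|_]; last exact: IH1.
case=> <-; apply: HP => u; rewrite ffunE eq_sym (negPf ab) => Eu.
by apply: IH1; rewrite Ey Ea.
Qed.

(** The tests in [slide] only compare parents with each other, with [None] or with [a] and [b], so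
    they are invariant under an injective renaming. *)
Lemma slide_relab s p a b :
  slide (relab s p) (s a) (s b) = relab s (slide p a b).
Proof.
rewrite /slide relab_eqNone !relab_eqSome relab_eq.
case: ifP => // _; case: ifP => _.
  apply/ffunP=> x; rewrite -(permKV s x); move: (_ x) => {}x.
  rewrite relabE !ffunE (inj_eq perm_inj) permK.
  case: (x =P b) => [_|_] /=; first by [].
  case: (p x) => //= y.  by rewrite -inj_tperm //; exact: perm_inj.
case: ifP => _.
  apply/ffunP=> x; rewrite -(permKV s x); move: (_ x) => {}x.
  by rewrite relabE !ffunE (inj_eq perm_inj) !permK; case: (x =P a).
case: ifP => // _.
apply/ffunP=> x; rewrite -(permKV s x); move: (_ x) => {}x.
by rewrite relabE !ffunE (inj_eq perm_inj) !permK; case: (x =P a).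
Qed.

Lemma sigma_pair_relab s p a b : is_tree p -> a != b ->
  sigma_pair (relab s p) (s a) (s b) = relab s (sigma_pair p a b).
Proof.
move=> Tp ab; rewrite !sigma_pairE ?is_tree_relab ?(inj_eq perm_inj) //.
rewrite slide_relab !relabM; congr relab.
by apply/permP=> x; rewrite !permM -inj_tperm //; exact: perm_inj.
Qed.

Lemma sigma_pair_tree p a b : is_tree p -> a != b -> is_tree (sigma_pair p a b).
Proof. by move=> Tp ab; rewrite sigma_pairE // is_tree_relab ?slide_tree. Qed.

(** * Generators acting on disjoint pairs of vertices *)

Lemma omap_tpermC a b c d (u : option 'I_n) :
  a != c -> a != d -> b != c -> b != d ->
  omap (tperm a b) (omap (tperm c d) u) = omap (tperm c d) (omap (tperm a b) u).
Proof.
move=> ac ad bc bd; case: u => //= y; congr Some.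
rewrite -!permM; congr (fun_of_perm _ y).
apply: perm_onC (@tperm_on _ c d) (@tperm_on _ a b) _.
rewrite disjoint_sym disjoints_subset; apply/subsetP=> z.
by rewrite !inE negb_or => /orP[] /eqP->; apply/andP.
Qed.

Lemma omap1 (u : option 'I_n) : omap (1%g : {perm 'I_n}) u = u.
Proof. by case: u => //= x; rewrite perm1. Qed.

(** A single form for all branches of [slide]: injectivity of [omap s] then settles every test made
    by a disjoint pair. *)
Lemma slide_off p a b : exists2 s, s = 1%g \/ s = tperm a b &
  forall x, x != a -> x != b -> slide p a b x = omap s (p x).
Proof.
rewrite /slide; case: ifP => _.
  by exists 1%g; [left|move=> x *; rewrite omap1].
case: ifP => _.
  by exists (tperm a b); [right|move=> x _ /negPf xb; rewrite ffunE xb].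
case: ifP => _.
  by exists 1%g; [left|move=> x /negPf xa _; rewrite omap1 ffunE xa].
case: ifP => _.
  by exists 1%g; [left|move=> x /negPf xa _; rewrite omap1 ffunE xa].
by exists 1%g; [left|move=> x *; rewrite omap1].
Qed.

Lemma slide_conditions p a b c d :
  a != c -> a != d -> b != c -> b != d ->
  let q := slide p a b in
  [/\ (q d == None) = (p d == None), (q d == Some c) = (p d == Some c),
      (q c == Some d) = (p c == Some d) & (q c == q d) = (p c == p d)].
Proof.
move=> ac ad bc bd q; have [s Hs Hq] := slide_off p a b.
have sc : s c = c by case: Hs => ->; rewrite ?perm1 ?tpermD.
have sd : s d = d by case: Hs => ->; rewrite ?perm1 ?tpermD.
rewrite /q !Hq; try by rewrite eq_sym.
rewrite omap_perm_eq -{1}[None]/(omap s None) omap_perm_eq; split=> //.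
  by rewrite -{1}sc -[Some (s c)]/(omap s (Some c)) omap_perm_eq.
by rewrite -{1}sd -[Some (s d)]/(omap s (Some d)) omap_perm_eq.
Qed.

(** Neither slide alters the tests of the other, so both sides take the same branches, and the
    results are compared vertex by vertex. *)
Lemma slideC p a b c d :
  a != c -> a != d -> b != c -> b != d ->
  slide (slide p a b) c d = slide (slide p c d) a b.
Proof.
move=> ac ad bc bd.
have [ca da cb db] : [/\ c != a, d != a, c != b & d != b].
  by split; rewrite eq_sym.
have [q1 q2 q3 q4] := slide_conditions p ac ad bc bd.
have [r1 r2 r3 r4] := slide_conditions p ca cb da db.
rewrite {1}/slide q1 q2 q3 q4 [RHS]/slide r1 r2 r3 r4 /slide.
case Eb0: (p b == None); case Ed0: (p d == None) => //.
all: case Eba: (p b == Some a); case Edc: (p d == Some c) => //.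
all: case Eab: (p a == Some b); case Ecd: (p c == Some d) => //.
all: case Ea: (p a == p b); case Ec: (p c == p d) => //.
all: apply/ffunP=> x; rewrite !ffunE.
all: rewrite ?(negPf ac) ?(negPf ad) ?(negPf bc) ?(negPf bd).
all: rewrite ?(negPf ca) ?(negPf da) ?(negPf cb) ?(negPf db).
all: case: (x =P a) => [?|_]; [subst x|].
all: try (case: (x =P b) => [?|_]; [subst x|]).
all: try (case: (x =P c) => [?|_]; [subst x|]).
all: try (case: (x =P d) => [?|_]; [subst x|]).
all: rewrite ?(negPf ac) ?(negPf ad) ?(negPf bc) ?(negPf bd).
all: rewrite ?(negPf ca) ?(negPf da) ?(negPf cb) ?(negPf db) /= ?tpermD //.
all: rewrite omap_tpermC //; case: ifP => //= _; rewrite ?tpermD //.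
Qed.

(** As [c] and [d] differ from [a], each lies below [a] exactly when its parent does; the slide
    replaces parents only by vertices linked to them in this way. *)
Lemma subtree_slide p a c d : is_tree p -> c != d -> a != c -> a != d ->
  subtree (slide p c d) a =1 subtree p a.
Proof.
move=> Tp cd ac ad; apply: subtree_charact; first exact: slide_tree.
have step x z : x != a -> p x = Some z -> subtree p a x = subtree p a z.
  by move=> /negPf xa Ex; rewrite subtreeE xa Ex.
rewrite eq_sym in ac; rewrite eq_sym in ad.
move=> y; rewrite [LHS]subtreeE; congr orb; rewrite /slide.
case: ifP => [_|/negbT]; first by [].
case Ed: (p d) => [w|] // _; case: ifP => [/eqP[Ewc]|_].
  rewrite ffunE; case: (y =P d) => [->|_]; first by rewrite Ed Ewc.
  case: (p y) => //= z; rewrite Ewc in Ed.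
  by case: tpermP => [->|->|//]; rewrite (step d c).
case: ifP => [/eqP Ec|_].
  rewrite ffunE; case: (y =P c) => [->|_] //; rewrite Ec; exact: step.
case: ifP => [/eqP Ec|_] //.
rewrite ffunE; case: (y =P c) => [->|_] //; rewrite Ec.
by rewrite (step d w).
Qed.

(** The renaming [s] fixes the root [b], so [a] remains or fails to be a child of the root, and its
    subtree is kept by [subtree_slide]. *)
Lemma wbar_slide p a b c d : is_tree p -> p b = None -> c != d ->
  a != c -> a != d -> b != c -> b != d ->
  wbar (slide p c d) a = wbar p a.
Proof.
move=> Tp Eb cd ac ad bc bd; rewrite /wbar.
have [s Hs Hq] := slide_off p c d.
have sb : s b = b by case: Hs => ->; rewrite ?perm1 ?tpermD // eq_sym.
rewrite Hq //; case Ea: (p a) => [r|] //=.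
rewrite slide_eqNone //.
have Hr x : (p x == None) = (x == b).
  apply/eqP/eqP => [Ex|-> //]; exact: tree_root_uniq Tp Ex Eb.
rewrite !Hr -{1}sb (inj_eq perm_inj); case: ifP => // _.
by apply: eq_card; apply: subtree_slide.
Qed.

Lemma sigma_pair_eqNone p a b x : is_tree p -> a != b -> x != a -> x != b ->
  (sigma_pair p a b x == None) = (p x == None).
Proof.
move=> Tp ab xa xb; rewrite sigma_pairE //.
have {1}<- : tperm a b x = x by rewrite tpermD // eq_sym.
by rewrite relab_eqNone slide_eqNone.
Qed.

Lemma wbar_sigma_pair p a b c d : is_tree p -> p b = None -> c != d ->
  a != c -> a != d -> b != c -> b != d ->
  wbar (sigma_pair p c d) a = wbar p a.
Proof.
move=> Tp Eb cd ac ad bc bd; rewrite sigma_pairE //.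
have {1}<- : tperm c d a = a by rewrite tpermD // eq_sym.
by rewrite wbar_relab ?slide_tree // (@wbar_slide p a b).
Qed.

Lemma sigma_pairC p a b c d : is_tree p -> a != b -> c != d ->
  a != c -> a != d -> b != c -> b != d ->
  sigma_pair (sigma_pair p a b) c d = sigma_pair (sigma_pair p c d) a b.
Proof.
move=> Tp ab cd ac ad bc bd.
have [ca da cb db] : [/\ c != a, d != a, c != b & d != b].
  by split; rewrite eq_sym.
rewrite [LHS]sigma_pairE ?sigma_pair_tree //.
rewrite [RHS]sigma_pairE ?sigma_pair_tree //.
rewrite (sigma_pairE Tp ab) (sigma_pairE Tp cd).
(* Each transposition fixes the other pair, so it can be pulled out of the second slide. *)
have := slide_relab (tperm a b) (slide p a b) c d; rewrite !tpermD // => ->.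
have := slide_relab (tperm c d) (slide p c d) a b; rewrite !tpermD // => ->.
rewrite !relabM slideC //; congr relab; apply/permP=> x.
have := @omap_tpermC a b c d (Some x) ac ad bc bd.
by rewrite !permM => -[->].
Qed.
End Trees.

(** Double counting: away from the root only the children of the root have non-zero weight, and
    every non-root vertex lies below exactly one of them. *)
Lemma sum_wbar n (p : tree n) r : is_tree p -> p r = None ->
  \sum_(x | x != r) wbar p x = n.-1.
Proof.
move=> Tp Er.
have Hr x : (p x == None) = (x == r).
  by apply/eqP/eqP => [Ex|-> //]; exact: tree_root_uniq Tp Ex Er.
have cover y : \sum_(x | p x == Some r) subtree p x y = (y != r).
  have /is_treeP[_ Hp] := Tp; elim/Hp: y => y IH.
  under eq_bigr do rewrite subtreeE.
  case Ey: (p y) => [z|]; last first.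
    move/eqP: Ey; rewrite Hr => /eqP->; rewrite eqxx big1 // => x Ex.
    by case: eqP => // E; rewrite -E Er in Ex.
  have -> : (y != r) = true by rewrite -Hr Ey.
  have [Ezr|Nzr] := eqVneq z r.
    (* The induction hypothesis at [r] says that [r] lies below none of its children, so only the
       child [y] itself contributes. *)
    rewrite (bigD1 y) /= ?Ey ?Ezr // eqxx big1 //= => x /andP[Ex xy].
    rewrite eq_sym (negPf xy) /=; have := IH r; rewrite Ey Ezr => /(_ erefl).
    rewrite eqxx => /eqP; rewrite sum_nat_eq0 => /forallP/(_ x).
    by rewrite Ex /= eqb0 => /negPf->.
  transitivity (\sum_(x | p x == Some r) subtree p x z); last by rewrite IH ?Nzr.
  apply: eq_bigr => x Ex; case: eqP => // E; subst y.
  by move: Ex Nzr; rewrite Ey => /eqP[->]; rewrite eqxx.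
transitivity (\sum_(x | p x == Some r) \sum_y subtree p x y).
  rewrite (bigID (fun x => p x == Some r)) /= [X in _ + X]big1 ?addn0.
    apply: eq_big => [x|x /andP[_ /eqP Ex]].
      by case: (x =P r) => [->|_] //=; rewrite Er.
    by rewrite /wbar Ex Er eqxx -sum1_card big_mkcond.
  move=> x /andP[xr Nx]; rewrite /wbar; case Ex: (p x) Nx => [z|] Nx.
    by rewrite Hr; case: (z =P r) Nx => // ->; rewrite eqxx.
  by move: xr; rewrite -Hr Ex.
rewrite exchange_big /=; under eq_bigr do rewrite cover.
by rewrite -big_mkcond sum1_card cardC1 card_ord.
Qed.

(** * Generators on augmented trees *)

Section Augmented.
Variable n : nat.
Implicit Types (p : tree n) (a b c d : 'I_n) (e : 'Z_n).

(** Labels start at 1 and indices at 0, so the number of a generator is the index of the upper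
    vertex of its pair. *)
Lemma sigmaAE p e a b : b = a.+1 :> nat ->
  sigmaA b (p, e) =
    (sigma_pair p a b, if p b == None then e + (wbar p a)%:R else e)%R.
Proof. by move=> ba; rewrite /sigmaA valK ba /= valK. Qed.

Lemma sigmaA_fst i p e : (sigmaA i (p, e)).1 = sigma i p.
Proof. by rewrite /sigmaA /sigma; case: insub => // a; case: insub. Qed.

Lemma actA_fst w p e : (actA w (p, e)).1 = actT w p.
Proof.
elim: w => //= i w <-; rewrite /actA /= -/(actA w (p, e)).
by case: (actA w _) => q e' /=; rewrite sigmaA_fst.
Qed.

Lemma actA_cat w1 w2 (te : tree n * 'Z_n) :
  actA (w1 ++ w2) te = actA w1 (actA w2 te).
Proof. exact: foldr_cat. Qed.

Lemma sigmaA_tree i (te : tree n * 'Z_n) : 0 < i < n ->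
  is_tree te.1 -> is_tree (sigmaA i te).1.
Proof.
case: te => p e /andP[i0 ilt] Tp.
have alt : i.-1 < n by apply: leq_ltn_trans (leq_pred i) ilt.
have -> : i = Ordinal ilt by [].
rewrite (@sigmaAE _ _ (Ordinal alt)) /=; last by rewrite prednK.
apply: sigma_pair_tree => //.
by rewrite -val_eqE /= neq_ltn -{2}(prednK i0) leqnn.
Qed.

Lemma sigmaAC i j (te : tree n * 'Z_n) : 0 < i -> i.+1 < j -> j < n ->
  is_tree te.1 -> sigmaA i (sigmaA j te) = sigmaA j (sigmaA i te).
Proof.
case: te => p e i0 ij jn; rewrite [(p, e).1]/= => Tp.
have iltn : i < n by apply: ltn_trans jn; apply: ltnW.
have i1n : i.-1 < n by apply: leq_ltn_trans (leq_pred i) iltn.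
have j0 : 0 < j by apply: leq_trans ij.
have j1n : j.-1 < n by apply: leq_ltn_trans (leq_pred j) jn.
pose a := Ordinal i1n; pose b := Ordinal iltn.
pose c := Ordinal j1n; pose d := Ordinal jn.
have ba : b = a.+1 :> nat by rewrite /= prednK.
have dc : d = c.+1 :> nat by rewrite /= prednK.
have ne (x y : 'I_n) : x < y -> x != y by rewrite -val_eqE neq_ltn => ->.
have lt_bc : b < c by rewrite -ltnS -dc.
have [lt_ab lt_cd] : a < b /\ c < d by rewrite ba dc.
have lt_ac := ltn_trans lt_ab lt_bc; have lt_bd := ltn_trans lt_bc lt_cd.
have [ab cd bc] := And3 (ne _ _ lt_ab) (ne _ _ lt_cd) (ne _ _ lt_bc).
have [ac bd] := conj (ne _ _ lt_ac) (ne _ _ lt_bd).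
have ad := ne _ _ (ltn_trans lt_ac lt_cd).
have [ca da cb db] : [/\ c != a, d != a, c != b & d != b].
  by split; rewrite eq_sym.
rewrite -[j]/(nat_of_ord d) -[i]/(nat_of_ord b).
rewrite (sigmaAE p e ba) (sigmaAE p e dc) (sigmaAE _ _ ba) (sigmaAE _ _ dc).
rewrite (sigma_pair_eqNone Tp cd bc bd) (sigma_pair_eqNone Tp ab da db).
rewrite (sigma_pairC Tp ab cd) //.
case: (p b =P None) => Eb; case: (p d =P None) => Ed //.
(* Both upper vertices cannot be the root; if just one is, the weight it adds is unchanged by the
   other generator. *)
- by case/eqP: bd; exact: tree_root_uniq Tp Eb Ed.
- by rewrite (wbar_sigma_pair Tp Eb cd ac ad bc bd).
- by rewrite (wbar_sigma_pair Tp Ed ab ca cb da db).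
Qed.

Lemma sigmaA_relab (s : {perm 'I_n}) p e a b c d :
  is_tree p -> a != b -> b = a.+1 :> nat -> d = c.+1 :> nat ->
  s a = c -> s b = d ->
  sigmaA d (relab s p, e) = (relab s (sigmaA b (p, e)).1, (sigmaA b (p, e)).2).
Proof.
move=> Tp ab ba dc sa sb; rewrite (sigmaAE _ _ ba) (sigmaAE _ _ dc) -sa -sb.
by rewrite sigma_pair_relab // relab_eqNone wbar_relab.
Qed.
End Augmented.

(** * [delta_n] as a rotation of the labels, and its [n]-th power *)

Section Delta.
Variable N : nat.
Implicit Types (p : tree N.+2) (x y : 'I_N.+2) (e : 'Z_N.+2).
Local Notation top := (ord_max : 'I_N.+2).

(* The tree reached by [sigma_{j+1} ... sigma_{n-1}], up to the renaming of
   vertices.  The top vertex and its parent [q] have exchanged the children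
   already met if [q] is still to be met, and those not yet met otherwise, so
   that nothing has changed at the end. *)
Definition partial_delta p j : tree N.+2 :=
  if p top is Some q then
    [ffun y => if (y != top) && ((j <= y) != (j <= q))
               then omap (tperm q top) (p y) else p y]
  else p.

(** Only [top] reaches the threshold [N.+1], and its parent [q] differs from it, so no exchange is
    recorded. *)
Lemma partial_delta_start p : is_tree p -> partial_delta p N.+1 = p.
Proof.
move=> Tp; rewrite /partial_delta; case Em: (p top) => [q|] //.
apply/ffunP=> y; rewrite ffunE.
have lt_top x : (N.+1 <= x) = (x == top).
  by rewrite -val_eqE /= eqn_leq [x <= _](ltn_ord x).
rewrite !lt_top; have [-> //|_] /= := eqVneq y top.
have [E|//] := eqVneq q top.
by rewrite E in Em; case: (tree_no_loop Tp Em).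
Qed.

Lemma partial_delta_end p : partial_delta p 0 = p.
Proof.
rewrite /partial_delta; case: (p top) => // q.
by apply/ffunP=> y; rewrite ffunE andbF.
Qed.

Lemma slide_partial_delta p x : is_tree p -> x != top ->
  slide (partial_delta p x.+1) x top = partial_delta p x.
Proof.
move=> Tp xm; rewrite /partial_delta /slide.
case Em: (p top) => [q|]; last by rewrite Em.
have qm : q != top.
  by apply/eqP=> E; rewrite E in Em; case: (tree_no_loop Tp Em).
have Lq := @tree_no_loop _ _ q Tp.
have C2 := @tree_no_two_cycle _ p top q Tp Em.
rewrite !ffunE eqxx /= Em xm /=.
have E (u v : 'I_N.+2) : (Some u == Some v) = (u == v) by [].
(* Meeting the parent [q] of [top] exchanges all their other children: earlier exchanges are undone,
   and the vertices still to come become the exchanged ones. *)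
rewrite E ltnn; have [Eqx|Nqx] := eqVneq q x.
  subst x; apply/ffunP=> y; rewrite !ffunE leqnn ltnn.
  have [-> |ym] /= := eqVneq y top; first by rewrite Em.
  have [->|yq] := eqVneq y q.
    by rewrite leqnn ltnn /= omap_tperm_id.
  have -> : (q < y) = (q <= y) by rewrite ltn_neqAle eq_sym val_eqE yq.
  by case: (q <= y) => //=; rewrite omap_tpermK.
have -> : (x < q) = (x <= q) by rewrite ltn_neqAle val_eqE eq_sym Nqx.
have lt_le y : y != x -> (x < y) = (x <= y).
  by rewrite ltn_neqAle val_eqE eq_sym => ->.
case: (boolP (x <= q)) => xq /=; apply/ffunP=> y.
  (* Here [q] has already been passed, so the parent of [x] is currently exchanged; the tests are
     read back through the transposition, and the slide undoes it. *)
  have conj_x u : (omap (tperm q top) (p x) == Some u) =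
      (p x == Some (tperm q top u)).
    by rewrite -[RHS](omap_perm_eq (tperm q top)) /= tpermK.
  rewrite !conj_x tpermL tpermR !ffunE.
  have [->|yx] := eqVneq y x; last first.
    by case: (p x == Some q); case: (p x == Some top);
       rewrite !ffunE ?(negPf yx) (lt_le _ yx).
  rewrite leqnn andbF.
  case: eqP => [->|Nxq]; first by rewrite ffunE eqxx.
  case: eqP => [->|Nxm]; first by rewrite ffunE eqxx.
  by rewrite ffunE xm ltnn /= omap_tperm_id.
(* Here [q] is still ahead: the parent of [x] is the original one, and the slide exchanges it. *)
rewrite !ffunE.
have [->|yx] := eqVneq y x; last first.
  by case: (p x == Some q); case: (p x == Some top);
     rewrite !ffunE ?(negPf yx) (lt_le _ yx).
rewrite leqnn xm /=.
case: eqP => [->|Nxm]; first by rewrite ffunE eqxx /= tpermR.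
case: eqP => [->|Nxq]; first by rewrite ffunE eqxx /= tpermL.
by rewrite ffunE ltnn andbF omap_tperm_id.
Qed.

Lemma partial_delta_top p j : is_tree p ->
  (partial_delta p j top == None) = (p top == None).
Proof.
move=> Tp; rewrite /partial_delta; case Em: (p top) => [q|]; last by rewrite Em.
by rewrite ffunE eqxx Em.
Qed.

(** Loop invariant for the last [k] letters of [delta_n]: [top] has come down to index [j], each
    vertex passed has moved up by one, and its weight, if added, is the one in the initial tree. *)
Lemma actA_partial_delta p e k j : is_tree p -> j + k = N.+1 ->
  exists s : {perm 'I_N.+2},
  [/\ is_tree (partial_delta p j),
      s top = j :> nat,
      forall y, y < j -> s y = y,
      forall y, j <= y -> y != top -> s y = y.+1 :> nat &
      actA (iota j.+1 k) (p, e) =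
        (relab s (partial_delta p j), if p top == None then
           e + (\sum_(x : 'I_N.+2 | ((j <= x) && (x != top))%N) wbar p x)%:R
         else e)%R].
Proof.
move=> Tp; elim: k j => [|k IH] j.
  rewrite addn0 => ->.
  exists 1%g; rewrite partial_delta_start // perm1; split=> //.
  - by move=> y _; rewrite perm1.
  - move=> y Ny; suff -> : y = top by rewrite eqxx.
    by apply/val_inj/eqP; rewrite eqn_leq Ny -ltnS ltn_ord.
  - rewrite relab1 big_pred0 ?addr0; first by case: ifP.
    move=> y; case: (leqP N.+1 y) => //= Hy.
    by rewrite -val_eqE /= eqn_leq Hy -ltnS ltn_ord.
rewrite addnS -addSn => jk.
have [s [Tq stop slow shigh E]] := IH _ jk.
have jN : j < N.+1 by rewrite -jk leq_addr.
have ne (u v : 'I_N.+2) : u < v -> u != v by rewrite -val_eqE neq_ltn => ->.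
pose x : 'I_N.+2 := Ordinal (ltnW jN : j < N.+2).
have xtop : x != top by rewrite -val_eqE neq_ltn jN.
have slide_x : slide (partial_delta p x.+1) x top = partial_delta p x.
  exact: slide_partial_delta.
have sx : s x = x by exact: slow.
have sxtop : s x != s top by rewrite (inj_eq perm_inj).
(* The next letter makes [top] exchange labels with [x], the vertex of index [j]. *)
exists (s * tperm (s x) (s top))%g; split.
- by rewrite -[j]/(nat_of_ord x) -slide_x slide_tree.
- by rewrite permM tpermR sx.
- move=> y yj; have sy : s y = y by apply: slow; rewrite ltnW.
  rewrite permM sy sx tpermD // eq_sym; apply: ne; first exact: yj.
  by rewrite stop ltnW.
- move=> y; rewrite leq_eqVlt => /orP[/eqP jy|jy] Ny.
    have -> : y = x by exact: val_inj.
    by rewrite permM tpermL stop.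
  rewrite permM tpermD ?(inj_eq perm_inj) 1?eq_sym //; first exact: shigh.
  by rewrite eq_sym; apply: ne.
rewrite [iota _ _]/= [LHS]/= -/(actA _ _) E.
rewrite -{1}stop (@sigmaAE _ _ _ (s x)) ?sx // -[in LHS]sx.
rewrite sigma_pairE ?is_tree_relab // slide_relab relabM slide_x.
congr pair; first by rewrite sx.
rewrite relab_eqNone partial_delta_top // wbar_relab //.
(* When [top] is the root no slide changes the tree, so the weight being added is that of [x] in
   [p]. *)
case: (p top =P None) => // ptop; rewrite /partial_delta ptop.
rewrite [in RHS](bigD1 x) /= ?leqnn // [in RHS]addnC natrD addrA.
congr (_ + _%:R + _)%R.
apply: eq_bigl => y; rewrite ltn_neqAle -[j == y]/(x == y) [y == x]eq_sym.
by case: (x == y); case: (j <= y); case: (y == top).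
Qed.

Definition rotation : {perm 'I_N.+2} := perm (@addIr _ (1 : 'I_N.+2)%R).

Lemma actA_delta p e : is_tree p ->
  actA (delta N.+2) (p, e) = (relab rotation p, e - (p top == None)%:R)%R.
Proof.
move=> Tp; have [s [_ stop slow shigh]] := actA_partial_delta e Tp (add0n N.+1).
rewrite partial_delta_end => ->; congr pair.
  congr relab; apply/permP=> y; rewrite permE; apply: val_inj => /=.
  rewrite [1 %% _]modn_small //.
  have [->|Ny] := eqVneq y top; first by rewrite stop /= addn1 modnn.
  rewrite shigh // addn1 modn_small //.
  by rewrite ltnS ltn_neqAle -[y == _ :> nat]/(y == top) Ny -ltnS ltn_ord.
case: eqP => [ptop|_]; last by rewrite subr0.
rewrite (eq_bigl (fun x => x != top)) // (sum_wbar Tp ptop) /=; congr (_ + _)%R.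
by apply/eqP; rewrite -subr_eq0 opprK -natrD addn1; apply/eqP/pchar_Zp.
Qed.

Lemma rotation_pow k x : (rotation ^+ k)%g x = (x + k%:R)%R.
Proof.
elim: k => [|k IH]; first by rewrite perm1 addr0.
by rewrite expgSr permM IH permE -addrA -mulrSr.
Qed.

Lemma actA_delta_pow k p e : is_tree p ->
  actA (wpow (delta N.+2) k) (p, e) =
    (relab (rotation ^+ k)%g p,
     e - (\sum_(j < k) (relab (rotation ^+ j)%g p top == None))%N%:R)%R.
Proof.
move=> Tp; elim: k => [|k IH]; first by rewrite relab1 big_ord0 subr0.
rewrite -[wpow _ _]/(delta N.+2 ++ wpow (delta N.+2) k) actA_cat IH.
rewrite actA_delta ?is_tree_relab // relabM -expgSr.
by rewrite big_ord_recr natrD opprD addrA.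
Qed.

Lemma actA_delta_full p e : is_tree p ->
  actA (wpow (delta N.+2) N.+2) (p, e) = (p, e - 1)%R.
Proof.
move=> Tp; rewrite actA_delta_pow //; congr pair.
  rewrite -[RHS]relab1; congr relab; apply/permP=> x.
  rewrite rotation_pow perm1.
  by rewrite (@pchar_Zp N.+2) ?addr0.
have /is_treeP[[r Hr] _] := Tp.
set S := (\sum_(j < _) _)%N; suff -> : S = 1 by []; rewrite {}/S.
(* After [j] rotations the root [r] has index [r + j] modulo [n], which is [top] for exactly one
   [j]. *)
rewrite (eq_bigr (fun j => (j == (top - r)%R) : nat)); last first.
  move=> j _; rewrite -{1}(permKV (rotation ^+ j)%g top) relab_eqNone Hr.
  rewrite -(inj_eq (@perm_inj _ (rotation ^+ j)%g)) permKV rotation_pow.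
  by rewrite (@natr_Zp N) [(r + _)%R]addrC -subr_eq eq_sym.
by rewrite (bigD1 (top - r)%R) //= eqxx big1 // => j /negPf->.
Qed.

(** The rotation carries the pair of indices [i-1], [i] to [i], [i+1], so this is equivariance under
    relabelling. *)
Lemma sigmaA_delta i (te : tree N.+2 * 'Z_N.+2) : is_tree te.1 ->
  0 < i -> i.+1 < N.+2 ->
  actA (delta N.+2) (sigmaA i te) = sigmaA i.+1 (actA (delta N.+2) te).
Proof.
case: te => p e; rewrite [(p, e).1]/= => Tp i0 iN.
have alt : i.-1 < N.+2 by rewrite prednK // ltnW // ltnW.
pose a := Ordinal alt; pose b := Ordinal (ltnW iN); pose d := Ordinal iN.
have ba : b = a.+1 :> nat by rewrite /= prednK.
have ne (u v : 'I_N.+2) : u < v -> u != v by rewrite -val_eqE neq_ltn => ->.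
have ab : a != b by apply: ne; rewrite ba.
have rotE (u v : 'I_N.+2) : v = u.+1 :> nat -> rotation u = v.
  move=> uv; apply: val_inj; rewrite permE /= [1 %% _]modn_small // addn1 -uv.
  by rewrite modn_small.
(* As [i.+1 < n], [top] is outside the pair, so the generator does not affect whether [top] is the
   root. *)
have btop : top != b by rewrite eq_sym; apply: ne; rewrite -ltnS.
have atop : top != a.
  by rewrite eq_sym; apply: ne; rewrite /= prednK // ltnW // -ltnS.
rewrite -[i in LHS]/(nat_of_ord b) -[i.+1]/(nat_of_ord d).
rewrite (actA_delta e Tp).
rewrite (@sigmaA_relab _ rotation p _ a b b d) //; try exact: rotE.
rewrite !(sigmaAE _ _ ba) actA_delta ?sigma_pair_tree //.
rewrite sigma_pair_eqNone //; congr pair.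
by case: ifP => //= _; rewrite addrAC.
Qed.

End Delta.

Lemma delta_cat m : delta m.+2 = delta m.+1 ++ [:: m.+1].
Proof. by rewrite /delta [m.+2.-1]/= -{1}[m.+1]addn1 iotaD add1n. Qed.

(** * The Garside identity in a group, from commutation and shift relations *)

Section Garside.
Variables (gT : finGroupType) (s : nat -> gT).
Local Open Scope group_scope.

Definition word_prod (w : seq nat) : gT := \prod_(i <- w) s i.

Lemma word_prod_cat w1 w2 : word_prod (w1 ++ w2) = word_prod w1 * word_prod w2.
Proof. exact: big_cat. Qed.

Lemma word_prod_wpow w k : word_prod (wpow w k) = word_prod w ^+ k.
Proof.
elim: k => [|k IH]; first by rewrite /word_prod /wpow big_nil.
by rewrite /wpow /= word_prod_cat IH expgS.
Qed.

Lemma deltaS m : word_prod (delta m.+2) = word_prod (delta m.+1) * s m.+1.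
Proof. by rewrite delta_cat word_prod_cat /word_prod big_seq1. Qed.

Lemma DeltaS m :
  word_prod (Delta m.+2) = word_prod (delta m.+2) * word_prod (Delta m.+1).
Proof.
have E : iota 2 m.+1 = rcons (iota 2 m) m.+2.
  by rewrite -[m.+1]addn1 iotaD cats1 add2n addn1.
by rewrite -word_prod_cat /Delta [m.+2.-1]/= E rev_rcons.
Qed.

(** The reversal of [delta m.+1], by which [Delta] grows on the right. *)
Definition descending_prod m : gT := \prod_(j < m) s (m - j).

Lemma descending_prodS m : descending_prod m.+1 = s m.+1 * descending_prod m.
Proof. by rewrite /descending_prod big_ord_recl subn0. Qed.

Definition far_commute n := forall i j,
  0 < i -> i.+1 < j -> j < n -> commute (s i) (s j).

Definition delta_shifts m := forall i, 0 < i -> i.+1 < m ->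
  word_prod (delta m) * s i = s i.+1 * word_prod (delta m).

Lemma commute_word n k w : far_commute n -> k < n ->
  {in w, forall i, 0 < i /\ i.+1 < k} -> commute (s k) (word_prod w).
Proof.
move=> fc kn; elim: w => [|i w IH] Hw.
  by rewrite /word_prod big_nil; exact: commute1.
rewrite /word_prod big_cons; apply: commuteM.
  by have [i0 ik] := Hw i (mem_head _ _); apply: commute_sym; exact: fc.
by apply: IH => j jw; apply: Hw; rewrite inE jw orbT.
Qed.

Lemma mem_delta m i : i \in delta m -> 0 < i < m.
Proof.
rewrite /delta mem_iota; case: m => [|m]; last by rewrite add1n.
by case: i => // i; rewrite addn0.
Qed.

Lemma mem_Delta m i : i \in Delta m -> 0 < i < m.
Proof.
case/flatten_mapP=> k; rewrite mem_rev mem_iota.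
move=> /andP[k2 km] /mem_delta/andP[-> ik].
apply: leq_trans ik _; case: m km => [|m] //=.
by rewrite addn0 ltnNge k2.
Qed.

(** The last factor of [delta m] commutes with [s i] and can be cancelled; thus the shift relation
    for [n] alone yields those for all smaller [m]. *)
Lemma delta_shifts_pred n m : far_commute n -> m <= n ->
  delta_shifts m -> delta_shifts m.-1.
Proof.
case: m => [|[|m]] //= fc mn sh i i0 im.
have := sh i i0 (ltnW im); rewrite deltaS.
have c : commute (s i) (s m.+1) by exact: fc.
by rewrite -mulgA -c !mulgA => /mulIg.
Qed.

(** Split [s m.+1] off [delta m.+2]; it commutes past [Delta m], whose letters are all below [m],
    and joins [descending_prod m]. *)
Lemma Delta_descending n m : far_commute n -> m < n ->
  word_prod (Delta m.+1) = word_prod (Delta m) * descending_prod m.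
Proof.
move=> fc; elim: m => [|m IH] mn.
  by rewrite /descending_prod big_ord0 mulg1.
rewrite DeltaS [X in _ * X = _]IH ?(ltnW mn) // deltaS descending_prodS.
case: m mn {IH} => [|m] mn.
  by rewrite /Delta /descending_prod /= /word_prod big_ord0 !big_nil !mul1g mulg1.
rewrite DeltaS !mulgA; congr (_ * _); rewrite -!mulgA; congr (_ * _).
apply: (@commute_word n) => // i /mem_Delta/andP[i0 im]; split=> //.
Qed.

Lemma delta_pow_shift m k : delta_shifts m.+1 -> k < m ->
  s m * word_prod (delta m.+1) ^+ k = word_prod (delta m.+1) ^+ k * s (m - k).
Proof.
move=> sh; elim: k => [|k IH] km; first by rewrite subn0 mulg1 mul1g.
rewrite expgSr mulgA IH ?(ltnW km) // -!mulgA; congr (_ * _).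
have lt_m : (m - k.+1).+1 < m.+1 by rewrite ltnS subnSK ?leq_subr // ltnW.
by rewrite sh ?subn_gt0 // subnSK // ltnW.
Qed.

Lemma delta_pow m : delta_shifts m.+2 ->
  word_prod (delta m.+1) ^+ m.+1 * descending_prod m.+1
    = word_prod (delta m.+2) ^+ m.+1.
Proof.
move=> sh; set d := word_prod (delta m.+2).
(* Only the first [k] factors of the descending product are used with the [k]-th powers; the next
   factor crosses [d ^+ k] to become [s m.+1], which extends [delta m.+1] to [d]. *)
suff H k : k <= m.+1 ->
    word_prod (delta m.+1) ^+ k * \prod_(j < k) s (m.+1 - j) = d ^+ k by exact: H.
elim: k => [|k IH] km; first by rewrite big_ord0 mulg1.
rewrite expgS big_ord_recr /= -mulgA [X in _ * X]mulgA IH 1?ltnW //.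
by rewrite -(delta_pow_shift sh km) mulgA -deltaS expgS.
Qed.

(** Expanding one [Delta] on the left and the other on the right leaves the smaller square in the
    middle, ready for induction. *)
Lemma Delta_square n m : far_commute n -> m < n -> delta_shifts m.+1 ->
  word_prod (Delta m.+1) ^+ 2 = word_prod (delta m.+1) ^+ m.+1.
Proof.
move=> fc; elim: m => [|m IH] mn sh.
  by rewrite expg1 /word_prod /Delta /delta /= big_nil expg1n.
transitivity (word_prod (delta m.+2) *
    (word_prod (Delta m.+1) ^+ 2 * descending_prod m.+1)).
  by rewrite !(expgSr _ 1) !expg1 {2}(Delta_descending fc) // DeltaS !mulgA.
by rewrite (IH (ltnW mn) (delta_shifts_pred fc mn sh)) delta_pow // -expgS.
Qed.
End Garside.

(** * The generators as elements of a finite permutation group *)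

Section Permutations.
Variable N : nat.
Local Notation n := N.+2.
Local Notation augmented_tree := {te : tree n * 'Z_n | is_tree te.1}.
Implicit Types (u v : augmented_tree) (p : tree n) (e : 'Z_n).
Implicit Types te : tree n * 'Z_n.

Lemma actA_delta_tree te : is_tree te.1 -> is_tree (actA (delta n) te).1.
Proof. by case: te => p e Tp; rewrite actA_delta // is_tree_relab. Qed.

Lemma actA_delta_inj te te' : is_tree te.1 -> is_tree te'.1 ->
  actA (delta n) te = actA (delta n) te' -> te = te'.
Proof.
case: te te' => [p e] [p' e'] Tp Tp'; rewrite !actA_delta //.
move=> E; have /relab_inj Ep := congr1 fst E; rewrite Ep in E *.
by congr pair; exact: addIr (congr1 snd E).
Qed.

(** Downward induction on [i]: the first letter applied by the injective [delta n] is [n-1], and the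
    shift relation passes injectivity from [i.+1] to [i]. *)
Lemma sigmaA_inj i te te' : 0 < i < n ->
  is_tree te.1 -> is_tree te'.1 -> sigmaA i te = sigmaA i te' -> te = te'.
Proof.
case/andP=> i0; rewrite ltnS => /subnKC; move: (N.+1 - i) => k.
elim: k i i0 te te' => [|k IH] i i0 te te' ik Tte Tte' E.
  apply: actA_delta_inj => //.
  have -> : delta n = delta i ++ [:: i].
    by rewrite -ik addn0; case: (i) i0 => // m _; exact: delta_cat.
  by rewrite !actA_cat [actA [:: i] te]E.
apply: actA_delta_inj => //; apply: (IH i.+1) => //; try exact: actA_delta_tree.
  by rewrite addSnnS.
have iN : i.+1 < n by rewrite -ik ltnS addnS ltnS leq_addr.
by rewrite -!sigmaA_delta // E.
Qed.

(** For [0 < i < n] the image is again a tree, so the default [u] is not reached. *)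
Definition sigma_fun i : {ffun augmented_tree -> augmented_tree} :=
  [ffun u => insubd u (sigmaA i (val u))].

Lemma val_sigma_fun i u : 0 < i < n -> val (sigma_fun i u) = sigmaA i (val u).
Proof.
by move=> Hi; rewrite ffunE insubdK //; apply: sigmaA_tree (valP u).
Qed.

(* Permutations are composed from left to right, while words act on the left;
   taking inverses reconciles the two conventions. *)
Definition sigma_inv i : {perm augmented_tree} :=
  (insubd (1 : {perm augmented_tree}) (sigma_fun i)
   : {perm augmented_tree})^-1%g.

Lemma val_sigma_inv i u : 0 < i < n ->
  val (((sigma_inv i)^-1)%g u) = sigmaA i (val u).
Proof.
move=> Hi; rewrite -val_sigma_fun // /sigma_inv invgK.
have inj : injectiveb (sigma_fun i).
  apply/injectiveP=> v w /(congr1 val); rewrite !val_sigma_fun //.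
  move/(sigmaA_inj Hi (valP v) (valP w)); exact: val_inj.
by rewrite /insubd; case: insubP => [s _ <-|/negP[]] //=; rewrite pvalE.
Qed.

Lemma val_word_prod w u : {in w, forall i, 0 < i < n} ->
  val (((word_prod sigma_inv w)^-1)%g u) = actA w (val u).
Proof.
elim: w => [|i w IH] Hw; first by rewrite /word_prod big_nil invg1 perm1.
rewrite /word_prod big_cons invMg permM val_sigma_inv ?Hw ?mem_head // IH //.
by move=> j jw; apply: Hw; rewrite inE jw orbT.
Qed.

Lemma sigma_inv_far_commute : far_commute sigma_inv n.
Proof.
move=> i j i0 ij jn; apply: invg_inj; apply/permP=> u; apply: val_inj.
have iv : 0 < i < n by rewrite i0 (ltn_trans _ jn) // ltnW.
have jv : 0 < j < n by rewrite jn andbT (ltn_trans _ ij).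
by rewrite !invMg !permM !val_sigma_inv // sigmaAC //; exact: (valP u).
Qed.

Lemma sigma_inv_delta_shifts : delta_shifts sigma_inv n.
Proof.
move=> i i0 iN; apply: invg_inj; apply/permP=> u; apply: val_inj.
have iv : 0 < i < n by rewrite i0 ltnW.
rewrite !invMg !permM val_sigma_inv // !val_word_prod ?val_sigma_inv //.
- by rewrite sigmaA_delta //; exact: (valP u).
- by move=> j /mem_delta.
- by move=> j /mem_delta.
Qed.

Lemma mem_wpow w k i : i \in wpow w k -> i \in w.
Proof. by case/flattenP=> v /nseqP[-> _]. Qed.

(** The word is read as a group element, [Delta^2] is replaced by [delta_n^n], and the result is
    read back as an action. Both consequences follow, with [k = 1] and [k = n]. *)
Lemma actA_Delta_pow k p e : is_tree p ->
  actA (wpow (Delta n) (2 * k)) (p, e) = (p, e - k%:R)%R.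
Proof.
move=> Tp; pose u : augmented_tree := exist _ (p, e) Tp.
have valid_delta : {in wpow (wpow (delta n) n) k, forall i, 0 < i < n}.
  by move=> i /mem_wpow/mem_wpow/mem_delta.
have valid_Delta : {in wpow (Delta n) (2 * k), forall i, 0 < i < n}.
  by move=> i /mem_wpow/mem_Delta.
rewrite -[(p, e) in LHS]/(val u) -val_word_prod // word_prod_wpow expgM.
rewrite (Delta_square sigma_inv_far_commute _ sigma_inv_delta_shifts) //.
rewrite -!word_prod_wpow val_word_prod // {valid_delta valid_Delta} /u /=.
elim: k => [|k IH]; first by rewrite subr0.
rewrite -[wpow _ _]/(wpow (delta n) n ++ wpow (wpow (delta n) n) k).
by rewrite actA_cat IH actA_delta_full // mulrSr opprD addrA.
Qed.
End Permutations.

Local Open Scope ring_scope.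

Theorem theorem1p9 (n : nat) (hn : (2 <= n)%N) :
  (forall (T : tree n) (e : 'Z_n), is_tree T ->
     actA (wpow (delta n) n) (T, e) = (T, e - 1)) /\
  (forall T : tree n, is_tree T -> actT (wpow (Delta n) 2) T = T) /\
  (forall (T : tree n) (e : 'Z_n), is_tree T ->
     actA (wpow (Delta n) (2 * n)) (T, e) = (T, e)).
Proof.
(* For [n = N.+2] the types ['Z_n] and ['I_n] coincide. *)
case: n hn => [|[|N]] // _; split; first by move=> T e; exact: actA_delta_full.
split=> [T HT|T e HT].
  (* The tree is lifted with second component [0], an arbitrary choice. *)
  by rewrite -(actA_fst _ _ 0%R) -[2%N]muln1 actA_Delta_pow.
by rewrite actA_Delta_pow // (@pchar_Zp N.+2) // subr0.
Qed.
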